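(* Suppose that $A\in\mathcal{B}_n$ is a matrix in linear block form (as defined in the context, with permutation matrix $P$) where the block $A_{ii}$ has order at least two for each $i=1,\ldots,\eta$. Let $A'$ be the limit of $\{\Gamma(A^m)\}_{m=1}^\infty$. Then the following are equivalent: (a) the matrix $PA'P^T$ is a JBD matrix; (b) for each $p=1,\ldots,\eta-1$, $\kappa_\eta$ divides $\kappa_p$, and $i-j\equiv i'-j'\pmod{\kappa_\eta}$ whenever $A^{(p,p+1)}_{ij}$ and $A^{(p,p+1)}_{i'j'}$ are nonzero matrices.
   Context: $\mathcal{B}=\{0,1\}$ is the two-element Boolean algebra ($1+1=1$) and $\mathcal{B}_n$ the set of $n\times n$ matrices over $\mathcal{B}$; powers are Boolean powers. For $A\in\mathcal{B}_n$, $\Gamma(A)=(\gamma_{ij})$ is the matrix with $\gamma_{ij}=1$ if $i\ne j$ and the inner product of rows $i$ and $j$ of $A$ is nonzero, and $\gamma_{ij}=0$ otherwise. A sequence of matrices in $\mathcal{B}_n$ converges if it is eventually constant, and then its limit is the eventual value (for $A$ as in the claim the sequence $\{\Gamma(A^m)\}$ converges). The digraph of $A$ is the digraph with adjacency matrix $A$; all digraphs are assumed simple (no loops), so $A$ has zero diagonal. A square matrix is irreducible if its digraph is strongly connected. The index of imprimitivity of an irreducible matrix of order at least two is the gcd of the lengths of all directed cycles of its digraph. A JBD ($J$ block diagonal) matrix is a matrix which, up to conjugation by a simultaneous permutation of rows and columns, is block diagonal with each diagonal block having all diagonal entries $0$ and all off-diagonal entries $1$. $A$ is in linear block form if there is a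 permutation matrix $P$ of order $n$ such that $PAP^T$ is block upper bidiagonal: its diagonal blocks are irreducible matrices $A_{11},\ldots,A_{\eta\eta}$, its superdiagonal blocks $A_{12},A_{23},\ldots,A_{\eta-1,\eta}$ are nonzero matrices, and all other blocks are zero; moreover, for $A_{ii}$ of order at least two with index of imprimitivity $\kappa_i$, $A_{ii}$ is partitioned (with square diagonal blocks) into $\kappa_i\times\kappa_i$ blocks in cyclic form, the only possibly nonzero blocks being $A^{(ii)}_{12},A^{(ii)}_{23},\ldots,A^{(ii)}_{\kappa_i-1,\kappa_i},A^{(ii)}_{\kappa_i,1}$, where $A^{(ii)}_{k,k+1}$ lies in the $k$th block row and $(k+1)$th block column (indices modulo $\kappa_i$). For $i\in\{1,\ldots,\kappa_p\}$ and $j\in\{1,\ldots,\kappa_{p+1}\}$, $A^{(p,p+1)}_{ij}$ denotes the submatrix of $PAP^T$ formed by the rows in the $i$th block row of $A_{pp}$ (those intersecting $A^{(pp)}_{i,i+1}$) and the columns in the $j$th block column of $A_{p+1,p+1}$ (those intersecting $A^{(p+1,p+1)}_{j-1,j}$). *)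

(* Defs.v *)
From HB Require Import structures.
From mathcomp Require Import all_boot all_order all_algebra.

Set Implicit Arguments.
Unset Strict Implicit.
Unset Printing Implicit Defensive.

Import GRing.Theory.
Local Open Scope ring_scope.

(* The two-element Boolean algebra, with [||] as addition and [&&] as
   multiplication.  It is an alias of [bool] because [bool] itself already
   carries the structure of the field with two elements in MathComp. *)
Definition boole : Type := bool.

HB.instance Definition _ := Finite.on boole.
HB.instance Definition _ := GRing.isNmodule.Build boole orbA orbC orFb.
HB.instance Definition _ := GRing.Nmodule_isComNzSemiRing.Build boole
  andbA andbC andTb andb_orl andFb isT.

Definition Gamma n (A : 'M[boole]_n) : 'M[boole]_n :=
  \matrix_(i, j) ((i != j) && (\sum_k A i k * A j k != 0))%:R.

Definition has_limit n (u : nat -> 'M[boole]_n) (L : 'M[boole]_n) : Prop :=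
  exists N : nat, forall m : nat, (N <= m)%N -> u m = L.

Definition adjacency n (A : 'M[boole]_n) : rel 'I_n := [rel i j | A i j != 0].

Definition irreducible_mx n (A : 'M[boole]_n) : Prop :=
  (0 < n)%N /\ forall i j, connect (adjacency A) i j.

(* The vertices of a directed cycle are distinct, so that its length is at
   most the order of the digraph. *)
Definition imprimitivity_index n (A : 'M[boole]_n) : nat :=
  (\big[gcdn/0]_(1 <= l < n.+1 |
     [exists c : l.-tuple 'I_n, ucycleb (adjacency A) c]) l)%N.

Definition offdiag_mx n : 'M[boole]_n := \matrix_(i, j) (i != j)%:R.

Definition JBD n (M : 'M[boole]_n) : Prop :=
  exists (Q : 'M[boole]_n) (r : nat) (d : 'I_r -> nat)
         (en : n = (\sum_(i < r) d i)%N),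
    is_perm_mx Q /\
    castmx (en, en) (Q *m M *m Q^T) = \mxdiag_(i < r) offdiag_mx (d i).

(* [ordS k] is the cyclic successor of [k]. *)
Definition cyclic_form k (w : 'I_k -> nat)
    (M : 'M[boole]_(\sum_(i < k) w i)) : Prop :=
  forall i j : 'I_k, j != ordS i -> submxblock M i j = 0.

(* There are [eta.+1] diagonal blocks.  The [p]th one has order [block_order w p];
   its rows and columns are divided into [kappa p] consecutive groups, the
   [i]th of which has size [w p i].  All indices start at 0. *)
Section LinearBlockForm.

Variables (eta : nat) (kappa : 'I_eta.+1 -> nat).
Variable w : forall p : 'I_eta.+1, 'I_(kappa p) -> nat.

Definition block_order (p : 'I_eta.+1) : nat := (\sum_(i < kappa p) w i)%N.

Definition block (M : 'M[boole]_(\sum_p block_order p)) (p p' : 'I_eta.+1) :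
  'M[boole]_(block_order p, block_order p') := submxblock M p p'.

Definition subblock (M : 'M[boole]_(\sum_p block_order p)) (p p' : 'I_eta.+1)
    (i : 'I_(kappa p)) (j : 'I_(kappa p')) : 'M[boole]_(w i, w j) :=
  submxblock (block M p p') i j.

(* The division of a diagonal block of order 1 is irrelevant. *)
Definition linear_block_shape (M : 'M[boole]_(\sum_p block_order p)) : Prop :=
  [/\ forall p, irreducible_mx (block M p p),
      forall p p' : 'I_eta.+1, p' = p.+1 :> nat -> block M p p' != 0,
      forall p p' : 'I_eta.+1,
        p' != p :> nat -> p' != p.+1 :> nat ->
        block M p p' = 0
    & forall p, (1 < block_order p)%N ->
        kappa p = imprimitivity_index (block M p p) /\
        cyclic_form (block M p p)].

End LinearBlockForm.

(* [P] and the sizes [w] put [A] in linear block form. *)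
Definition linear_block_form n (A P : 'M[boole]_n) eta
    (kappa : 'I_eta.+1 -> nat) (w : forall p, 'I_(kappa p) -> nat)
    (en : n = (\sum_p block_order w p)%N) : Prop :=
  is_perm_mx P /\ linear_block_shape (castmx (en, en) (P *m A *m P^T)).

(* Main.v *)
(** Call two vertices related when, for some [m], walks of length [m] from each
    of them end at a common vertex; off the diagonal this is the limit of
    [Gamma (A ^+ m)], so that the limit is JBD if and only if the relation is
    transitive.  Let [k] be the period of the last block.  Every vertex reaches
    the last block, and long walks inside it are constrained only by their
    length modulo [k]; hence [u] and [v] are related if and only if they have a
    common phase, a phase of [u] being the residue modulo [k] of
    (group of [z]) - (length) for some walk from [u] to a vertex [z] of the
    last block.
    A vertex with two phases is related to two vertices of the last block that
    are not related to each other, so transitivity means that the phase is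
    unique, and then it is a function [f] with [f v = f u + 1] modulo [k] along
    every edge.  Such an [f] exists if and only if [k] divides all the periods
    and the group number, up to a constant on each block, has this property
    along the edges between consecutive blocks too, which is condition (b). *)
Require Import Defs.
From mathcomp Require Import all_boot all_order all_fingroup all_algebra zify.

Set Implicit Arguments.
Unset Strict Implicit.
Unset Printing Implicit Defensive.

Import GRing.Theory.
Local Open Scope ring_scope.

(** * Multiples contained in an additive semigroup of natural numbers *)

Section NumericalSemigroup.

Variable R : nat -> Prop.
Hypotheses (R0 : R 0%N) (RD : forall m n, R m -> R n -> R (m + n)%N).

Definition eventually_multiples (d : nat) : Prop :=
  exists N : nat, forall m : nat, (N <= m)%N -> (d %| m)%N -> R m.

Lemma semigroup_mul x a : R a -> R (x * a)%N.
Proof. by move=> Ra; elim: x => // x IH; rewrite mulSn; apply: RD. Qed.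

(* A large multiple [m] of [gcdn d l] is congruent to [x * l] modulo [d] for
   some [x < d]; then [m - (d - x) * a - x * (a + l)] is a multiple of [d]. *)
Lemma eventually_multiples_gcd d a l :
  (0 < d)%N -> eventually_multiples d -> R a -> R (a + l)%N ->
  eventually_multiples (gcdn d l).
Proof.
move=> d0 [N HN] Ra Ral.
have [->|l0] := posnP l; first by rewrite gcdn0; exists N.
exists (N + d * (a + l))%N => m mN /dvdnP[q Eq].
case: (egcdnP d l0) => km kn Ek _; rewrite gcdnC in Ek.
pose x := ((q * km) %% d)%N.
have xd : (x < d)%N by rewrite ltn_mod.
have Em : (m + q * kn * d = x * l + q * km %/ d * l * d)%N.
  have := divn_eq (q * km) d; rewrite -/x => E1.
  have : (q * km * l = q * kn * d + m)%N by rewrite -mulnA Ek mulnDr mulnA Eq.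
  by rewrite {1}E1; nia.
have le1 : (x * l <= d * l)%N by rewrite leq_mul2r ltnW ?orbT.
pose r := (m - d * a - x * l)%N.
have rN : (N <= r)%N by rewrite /r; nia.
have Rr : R r.
  apply: HN => //.
  have -> : r = (m - x * l - d * a)%N by rewrite /r; lia.
  apply: dvdn_sub; last exact: dvdn_mulr.
  apply/dvdnP; exists (q * km %/ d * l - q * kn)%N; nia.
have -> : m = (r + ((d - x) * a + x * (a + l)))%N by rewrite /r; nia.
by apply: RD => //; apply: RD; apply: semigroup_mul.
Qed.

End NumericalSemigroup.

(** * Walks, potentials and common prey in a finite digraph *)

Section Walks.

Variables (T : finType) (e : rel T).

Definition walk (m : nat) (u v : T) : Prop :=
  exists p : seq T, [/\ path e u p, size p = m & last u p = v].

Lemma walk0 u : walk 0 u u.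
Proof. by exists [::]. Qed.

Lemma walk1 u v : e u v -> walk 1 u v.
Proof. by move=> uv; exists [:: v]; rewrite /= uv. Qed.

Lemma walk_cat m n u v x : walk m u v -> walk n v x -> walk (m + n) u x.
Proof.
move=> [p [p1 <- <-]] [q [q1 <- <-]].
by exists (p ++ q); rewrite cat_path p1 size_cat last_cat.
Qed.

Lemma walkS m u v : walk m.+1 u v <-> exists x, e u x /\ walk m x v.
Proof.
split=> [[[|x p] []//= /andP[ux xp] [<-] <-]|[x [ux xv]]].
  by exists x; split=> //; exists p.
exact: (walk_cat (walk1 ux) xv).
Qed.

Lemma connect_walk u v : connect e u v -> exists m, walk m u v.
Proof. by case/connectP=> p p1 ->; exists (size p), p. Qed.

Lemma ucycle_walk l (c : l.-tuple T) :
  (0 < l)%N -> ucycleb e c -> exists x, walk l x x.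
Proof.
case: c => [[|x p] /= /eqP <-] // _ /andP[cp _].
by exists x, (rcons p x); rewrite size_rcons last_rcons.
Qed.

Lemma walk_extend m u : (forall x, exists y, e x y) -> exists v, walk m u v.
Proof.
move=> he; elim: m u => [|m IH] u; first by exists u; apply: walk0.
have [x ux] := he u; have [v xv] := IH x.
by exists v; apply/walkS; exists x.
Qed.

(** For positive [k], an integer lift of a homomorphism from the digraph to the directed cycle of
    length [k]. *)
Definition potential (k : nat) (f : T -> int) : Prop :=
  forall u v, e u v -> (k %| f v - f u - 1)%Z.

Lemma potential_walk k f m u v :
  potential k f -> walk m u v -> (k %| f v - f u - m%:Z)%Z.
Proof.
move=> fP; elim: m u => [|m IH] u.
  by case=> [[|x p] []//= _ _ <-]; rewrite subrr.
case/walkS=> x [/fP/dvdzP[a Ea] /IH/dvdzP[b Eb]].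
by apply/dvdzP; exists (a + b); lia.
Qed.

Lemma connect_invariant (k : nat) (h : T -> int) u v :
  (forall x y, e x y -> (k %| h y - h x)%Z) -> connect e u v ->
  (k %| h v - h u)%Z.
Proof.
move=> hP /connect_walk[m]; elim: m u => [|m IH] u.
  by case=> [[|x p] []//= _ _ <-]; rewrite subrr.
case/walkS=> x [/hP/dvdzP[a Ea] /IH/dvdzP[b Eb]].
by apply/dvdzP; exists (a + b); lia.
Qed.

Definition common_prey (u v : T) : Prop :=
  exists m x, walk m u x /\ walk m v x.

End Walks.

Lemma walk_map (T S : finType) (e : rel T) (e' : rel S) (h : T -> S) m u v :
  (forall x y, e x y -> e' (h x) (h y)) -> walk e m u v ->
  walk e' m (h u) (h v).
Proof.
move=> he; elim: m u => [|m IH] u.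
  by case=> [[|x p] []//= _ _ <-]; apply: walk0.
by case/walkS=> x [ux /IH xv]; apply/walkS; exists (h x); split=> //; apply: he.
Qed.

(** * Digraphs in which every vertex reaches a closed, strongly connected set [S] of period [k] *)

Section Sink.

Variables (T : finType) (e : rel T) (S : pred T) (k : nat) (g : T -> int).
Hypotheses (k0 : (0 < k)%N)
  (out : forall u, exists v, e u v)
  (reach : forall u, exists2 v, S v & connect e u v)
  (S_closed : forall u v, S u -> e u v -> S v)
  (S_connect : forall u v, S u -> S v -> connect e u v)
  (S_period : forall u, S u ->
     eventually_multiples (fun m => walk e m u u) k)
  (gP : forall u v, S u -> e u v -> (k %| g v - g u - 1)%Z).

Lemma sink_walk m u v :
  S u -> walk e m u v -> S v /\ (k %| g v - g u - m%:Z)%Z.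
Proof.
move=> + uv; elim: m u uv => [|m IH] u.
  by case=> [[|x p] []//= _ _ <-] Su; rewrite subrr.
case/walkS=> x [ux xv] Su; have Sx := S_closed Su ux.
have /dvdzP[a Ea] := gP Su ux; have [Sv /dvdzP[b Eb]] := IH _ xv Sx.
by split=> //; apply/dvdzP; exists (a + b); lia.
Qed.

(** Any fixed walk from [u] to [v] has its length in the residue class that [g] prescribes; a much
    longer length in this class leaves a large multiple of [k], filled by a closed walk at [u]. *)
Lemma sink_reach_length u v : S u -> S v ->
  exists N : nat, forall m : nat, (N <= m)%N ->
    (k %| g v - g u - m%:Z)%Z -> walk e m u v.
Proof.
move=> Su Sv; have [a uv] := connect_walk (S_connect Su Sv).
have [N HN] := S_period Su; have [_ /dvdzP[q Eq]] := sink_walk Su uv.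
exists (N + a)%N => m mN /dvdzP[r Er].
rewrite -(subnK (leq_trans (leq_addl _ _) mN)); apply: walk_cat uv.
apply: HN; first by lia.
suff: (k%:Z %| (m - a)%N%:Z)%Z by rewrite dvdzE.
by apply/dvdzP; exists (q - r); lia.
Qed.

Definition phase (u : T) (c : int) : Prop :=
  exists m z, [/\ S z, walk e m u z & (k %| c + m%:Z - g z)%Z].

Lemma phase_exists u : exists c, phase u c.
Proof.
have [z Sz /connect_walk[m uz]] := reach u.
by exists (g z - m%:Z), m, z; split=> //; rewrite subrK subrr.
Qed.

(** If the phase comes from a walk of length [m] to [x], then walks from [z] to [x] have lengths
    congruent to [m]; adding a long closed walk at [x] to the first one makes a common length
    available. *)
Lemma phase_common_prey u c z :
  S z -> phase u c -> (k %| c - g z)%Z -> common_prey e u z.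
Proof.
move=> Sz [m [x [Sx ux /dvdzP[a Ea]]]] /dvdzP[b Eb].
have [N HN] := S_period Sx; have [N' HN'] := sink_reach_length Sz Sx.
pose l := (k * (N + N'))%N.
have lN : (N + N' <= l)%N by rewrite leq_pmull.
exists (m + l)%N, x; split.
  by apply: walk_cat ux _; apply: HN; [lia | apply: dvdn_mulr].
apply: HN'; first by lia.
by apply/dvdzP; exists (- a + b - (N + N')%N%:Z); rewrite /l; lia.
Qed.

Lemma sink_common_prey u v :
  S u -> S v -> common_prey e u v -> (k %| g u - g v)%Z.
Proof.
move=> Su Sv [m [x [ux vx]]].
have [_ /dvdzP[a Ea]] := sink_walk Su ux.
have [_ /dvdzP[b Eb]] := sink_walk Sv vx.
by apply/dvdzP; exists (b - a); lia.
Qed.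

(** The class function makes the relation transitive, which forces phases to be unique modulo [k];
    any choice of phases is then a potential. *)
Lemma common_prey_class_potential (C : eqType) (c : T -> C) :
  (forall u v, common_prey e u v <-> c u = c v) ->
  exists f, potential e k f.
Proof.
move=> cP; have [f fP] := fin_all_exists phase_exists.
have phase_uniq u a b : phase u a -> phase u b -> (k %| a - b)%Z.
  (* Walking on from [x] stays in [S] and raises [g] by one at each step, so every residue is
     attained there. *)
  have vertex d : phase u d -> exists2 z, S z & (k %| d - g z)%Z.
    move=> [m [x [Sx _ _]]].
    pose n := `|(d - g x) %% k|%Z%N.
    have [z xz] := walk_extend n x out.
    have [Sz /dvdzP[q Eq]] := sink_walk Sx xz.
    exists z => //; apply/dvdzP; exists (((d - g x) %/ k)%Z - q).
    have := divz_eq (d - g x) k.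
    have : n%:Z = ((d - g x) %% k)%Z by rewrite /n gez0_abs // modz_ge0 // -lt0n.
    lia.
  move=> ua ub; have [y Sy ay] := vertex _ ua; have [z Sz bz] := vertex _ ub.
  (* Both [y] and [z] are related to [u], hence to each other, and inside [S] this forces equal
     values of [g] modulo [k]. *)
  have /cP uy := phase_common_prey Sy ua ay.
  have /cP uz := phase_common_prey Sz ub bz.
  have /cP/(sink_common_prey Sy Sz)/dvdzP[q Eq] : c y = c z by rewrite -uy.
  case/dvdzP: ay => s Es; case/dvdzP: bz => t Et.
  by apply/dvdzP; exists (s + q - t); lia.
(* Prepending the edge to a walk from [v] lowers the phase by one. *)
exists f => u v uv; have : phase u (f v - 1).
  have [m [z [Sz vz /dvdzP[q Eq]]]] := fP v.
  exists m.+1, z; split=> //; first by apply/walkS; exists v.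
  by apply/dvdzP; exists q; lia.
by move=> /phase_uniq/(_ (fP u)); rewrite addrAC.
Qed.

Lemma potential_common_prey f :
  potential e k f ->
  forall u v, common_prey e u v <-> (f u %% k)%Z = (f v %% k)%Z.
Proof.
move=> fP u v; split.
  move=> [m [x [/(potential_walk fP)/dvdzP[a Ea]]]].
  move=> /(potential_walk fP)/dvdzP[b Eb].
  by apply/eqP; rewrite eqz_mod_dvd; apply/dvdzP; exists (b - a); lia.
move/eqP; rewrite eqz_mod_dvd => /dvdzP[q Eq].
have [y Sy /connect_walk[m uy]] := reach u.
have [z Sz /connect_walk[n vz]] := reach v.
have /dvdzP[a Ea] := potential_walk fP uy.
have /dvdzP[b Eb] := potential_walk fP vz.
(* This walk serves only for comparison: along it [f] and [g] change by the same amount modulo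
   [k]. *)
have [i zy] := connect_walk (S_connect Sz Sy).
have /dvdzP[d Ed] := potential_walk fP zy.
have [_ /dvdzP[d' Ed']] := sink_walk Sz zy.
have [N HN] := S_period Sy; have [N' HN'] := sink_reach_length Sz Sy.
(* The summand [n] keeps [m + l - n], the length left after the walk from [v] to [z], at least
   [N']. *)
pose l := (k * (N + N' + n))%N.
have lN : (N + N' + n <= l)%N by rewrite leq_pmull.
exists (m + l)%N, y; split.
  by apply: walk_cat uy _; apply: HN; [lia | apply: dvdn_mulr].
have -> : (m + l = n + (m + l - n))%N by lia.
apply: walk_cat vz _; apply: HN'; first by lia.
apply/dvdzP; exists (d' - (N + N' + n)%N%:Z + a - d - b + q).
rewrite -subzn; lia.
Qed.

End Sink.

(** * Boolean matrices, their digraphs and JBD matrices *)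

Lemma mx_neq0_ex (V : nmodType) m n (B : 'M[V]_(m, n)) :
  B != 0 -> exists i j, B i j != 0.
Proof.
move=> B0; have /existsP[i /existsP[j Bij]] : [exists i, exists j, B i j != 0].
  apply: contraNT B0 => /existsPn B0; apply/eqP/matrixP => i j.
  by have /existsPn/(_ j) := B0 i; rewrite negbK mxE => /eqP.
by exists i, j.
Qed.

Lemma boole_sum_neq0 (I : finType) (F : I -> boole) :
  (\sum_i F i != 0) = [exists i, F i != 0].
Proof.
apply/idP/existsP => [|[i Fi]]; last first.
  by rewrite (bigD1 i) //=; move: Fi; case: (F i).
move=> sF; apply/existsP; apply: contraNT sF; rewrite negb_exists => /forallP F0.
by apply/eqP/big1 => i _; apply/eqP/negPn/F0.
Qed.

Lemma boole_mul_neq0 (a b : boole) : (a * b != 0) = (a != 0) && (b != 0).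
Proof. by case: a; case: b. Qed.

Lemma boole_nat_neq0 (b : bool) : (b%:R != 0 :> boole) = b.
Proof. by case: b. Qed.

Lemma boole_eq (a b : boole) : (a != 0 <-> b != 0) -> a = b.
Proof. by case: a; case: b => // -[h h']; [have := h isT | have := h' isT]. Qed.

Section BooleanMatrix.

Variable n : nat.
Implicit Types A M L : 'M[boole]_n.

Lemma mx_exp_walk A m i j : (A ^+ m) i j != 0 <-> walk (adjacency A) m i j.
Proof.
elim: m i => [|m IH] i.
  rewrite expr0 mxE boole_nat_neq0; split=> [/eqP->|]; first exact: walk0.
  by case=> [[|x p] []//= _ _ ->].
rewrite exprS mxE boole_sum_neq0; split.
  case/existsP=> x; rewrite boole_mul_neq0 => /andP[ix /IH xj].
  by apply/walkS; exists x.
case/walkS=> x [ix /IH xj]; apply/existsP; exists x.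
by rewrite boole_mul_neq0 xj andbT.
Qed.

Lemma Gamma_neq0 A i j :
  Gamma A i j != 0 <-> i != j /\ exists k, A i k != 0 /\ A j k != 0.
Proof.
rewrite mxE boole_nat_neq0 boole_sum_neq0; split.
  case/andP=> ij /existsP[k]; rewrite boole_mul_neq0 => /andP[ik jk].
  by split=> //; exists k.
case=> ij [k [ik jk]]; rewrite ij; apply/existsP; exists k.
by rewrite boole_mul_neq0 ik.
Qed.

(** Common prey persists: since every vertex has a successor, two walks that meet can be prolonged
    together into the range where the sequence is constant. *)
Lemma limit_Gamma_common_prey A L :
  (forall i, exists j, adjacency A i j) ->
  has_limit (fun m => Gamma (A ^+ m)) L ->
  forall i j, L i j != 0 <-> i != j /\ common_prey (adjacency A) i j.
Proof.
move=> out [N LN] i j; split.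
  rewrite -(LN N) // Gamma_neq0 => -[ij [k [/mx_exp_walk ik /mx_exp_walk jk]]].
  by split=> //; exists N, k.
case=> ij [m [x [ix jx]]]; have [y xy] := walk_extend N x out.
rewrite -(LN (m + N)%N) ?leq_addl // Gamma_neq0; split=> //.
by exists y; split; apply/mx_exp_walk; apply: walk_cat xy.
Qed.

Lemma perm_conjE (s : {perm 'I_n}) A i j :
  (perm_mx s *m A *m (perm_mx s)^T) i j = A (s i) (s j).
Proof. by rewrite tr_perm_mx -row_permE -col_permE !mxE. Qed.

Lemma perm_conj_exp (s : {perm 'I_n}) A m :
  (perm_mx s *m A *m (perm_mx s)^T) ^+ m =
  perm_mx s *m A ^+ m *m (perm_mx s)^T.
Proof.
have ss : (perm_mx s)^T *m perm_mx s = 1%:M :> 'M[boole]_n.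
  by rewrite tr_perm_mx -perm_mxM mulVg perm_mx1.
elim: m => [|m IH].
  by rewrite !expr0 mulmx1 tr_perm_mx -perm_mxM mulgV perm_mx1.
rewrite !exprS IH /GRing.mul /= !mulmxA; congr (_ *m _ *m _).
by rewrite -[LHS]mulmxA ss mulmx1.
Qed.

Lemma Gamma_perm_conj (s : {perm 'I_n}) A :
  Gamma (perm_mx s *m A *m (perm_mx s)^T) =
  perm_mx s *m Gamma A *m (perm_mx s)^T.
Proof.
apply/matrixP => i j; rewrite perm_conjE; apply: boole_eq.
rewrite !Gamma_neq0 (inj_eq perm_inj).
split=> -[ij [k [ik jk]]]; split=> //.
  by exists (s k); rewrite -!perm_conjE.
by exists (s^-1%g k); rewrite !perm_conjE permKV.
Qed.

Lemma mxdiag_offdiagE r (d : 'I_r -> nat) i j :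
  (\mxdiag_(i < r) offdiag_mx (d i)) i j =
  ((i != j) && (tagnat.sig1 i == tagnat.sig1 j))%:R.
Proof.
rewrite mxE; case: eqVneq => [e|_]; last by rewrite mxE andbF.
rewrite andbT.
(* In terms of ranks, both positions can be moved into one block by rewriting with [e]. *)
have -> : (i == j) =
    (tagnat.Rank _ (tagnat.sig2 i) == tagnat.Rank _ (tagnat.sig2 j)).
  by rewrite !tagnat.sig2K.
move: (tagnat.sig2 i) (tagnat.sig2 j); rewrite -e => x y.
by rewrite conform_mx_id mxE -[in RHS]val_eqE tagnat.eq_Rank eqxx.
Qed.

Lemma JBD_classes M : JBD M ->
  exists c : 'I_n -> nat, forall i j, M i j != 0 <-> i != j /\ c i = c j.
Proof.
move=> [Q [r [d [en [/is_perm_mxP[s ->] EM]]]]].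
(* Vertex [i] of [M] sits at position [s^-1 i] of the permuted matrix; its class is the diagonal
   block there. *)
exists (fun i => tagnat.sig1 (cast_ord en (s^-1%g i)) : nat) => i j.
have := congr1 (fun B : 'M_ _ => B (cast_ord en (s^-1%g i))
   (cast_ord en (s^-1%g j))) EM.
rewrite castmxE !cast_ordK perm_conjE !permKV mxdiag_offdiagE => ->.
rewrite boole_nat_neq0 (inj_eq (@cast_ord_inj _ _ _)) (inj_eq perm_inj).
by split=> [/andP[-> /eqP->]|[-> /val_inj->]] //; rewrite eqxx.
Qed.

Lemma classes_JBD (C : eqType) (c : 'I_n -> C) M :
  (forall i j, M i j != 0 <-> i != j /\ c i = c j) -> JBD M.
Proof.
move=> Mc; pose P := preim_partition c [set: 'I_n].
have PP : partition P [set: 'I_n] := preim_partitionP c _.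
pose d (i : 'I_#|P|) := #|enum_val i|.
have en : n = (\sum_(i < #|P|) d i)%N.
  by rewrite -[LHS]card_ord -cardsT (card_partition PP) big_enum_val.
(* Listing the vertices fibre by fibre gives the permutation. *)
pose h (k : 'I_(\sum_(i < #|P|) d i)) : 'I_n := enum_val (tagnat.sig2 k).
have trivP : trivIset P by case/and3P: PP.
have h_block k : pblock P (h k) = enum_val (tagnat.sig1 k).
  by apply: def_pblock => //; apply: enum_valP.
have h_inj : injective h.
  move=> k l hkl; have := h_block k; rewrite hkl h_block => /enum_val_inj e.
  apply: tagnat.sig_inj; rewrite !tagnat.sigE12.
  move: hkl; rewrite /h; move: (tagnat.sig2 k) (tagnat.sig2 l).
  by rewrite -e => x y /enum_val_inj->.
have h_class k l : (c (h k) == c (h l)) = (tagnat.sig1 k == tagnat.sig1 l).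
  rewrite -(inj_eq enum_val_inj) -!h_block eq_pblock //; last first.
    by rewrite (cover_partition PP) inE.
  rewrite pblock_equivalence_partition ?inE // => x y z _ _ _ /=.
  by split=> // /eqP->.
exists (perm_mx (perm (inj_comp h_inj (@cast_ord_inj _ _ en)))), #|P|, d, en.
split; first exact: perm_mx_is_perm.
apply/matrixP => k l; apply: boole_eq.
rewrite castmxE perm_conjE mxdiag_offdiagE boole_nat_neq0 !permE /= !cast_ordKV.
rewrite -h_class -(inj_eq h_inj) Mc.
by split=> [[-> ->]|/andP[-> /eqP]] //; rewrite eqxx.
Qed.

Lemma irreducible_out M i :
  irreducible_mx M -> (1 < n)%N -> exists j, adjacency M i j.
Proof.
move=> [_ conn] n1; have [j ij] : exists j, j != i.
  have [->|] := eqVneq i (Ordinal n1); first by exists (Ordinal (ltnW n1)).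
  by rewrite eq_sym; exists (Ordinal n1).
have /connectP[[|x p] /=] := conn i j; first by move=> _ ji; rewrite ji eqxx in ij.
by case/andP=> ix _ _; exists x.
Qed.

(** Around a cycle the potential returns to its initial value, so [k] divides the length of every
    cycle. *)
Lemma imprimitivity_index_dvdn M (k : nat) f :
  potential (adjacency M) k f -> (k %| imprimitivity_index M)%N.
Proof.
move=> fP; rewrite /imprimitivity_index big_nat_cond.
apply: (big_ind (fun l => (k %| l)%N)) => [|a b ka kb|l];
  rewrite ?dvdn0 ?dvdn_gcd ?ka //.
case/andP=> /andP[l0 _] /existsP[c /(ucycle_walk l0)[x /(potential_walk fP)]].
by rewrite subrr sub0r rpredN dvdzE.
Qed.

(** Lengths of closed walks at [i] form a semigroup. A round trip to a vertex [x] of a cycle, made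
    without and with the cycle, gives two lengths that differ by the length of the cycle, which can
    thus be absorbed into the gcd. *)
Lemma irreducible_period M i : irreducible_mx M -> (1 < n)%N ->
  eventually_multiples (fun m => walk (adjacency M) m i i)
    (imprimitivity_index M).
Proof.
move=> irrM n1; have [_ conn] := irrM; set R := fun m => _.
have R0 : R 0%N := walk0 _ _.
have RD m l : R m -> R l -> R (m + l)%N by apply: walk_cat.
have [j ij] := irreducible_out i irrM n1.
have [a ji] := connect_walk (conn j i).
have Ra : R a.+1 by apply/walkS; exists j.
(* The fold starts from a positive [d], the length of some closed walk, because the empty gcd is
   0. *)
suff H : forall d, (0 < d)%N -> eventually_multiples R d ->
    eventually_multiples R (gcdn d (imprimitivity_index M)).
  have [||N HN] := H a.+1 => //.
    by exists 0%N => m _ /dvdnP[q ->]; apply: semigroup_mul.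
  by exists N => m mN dm; apply: HN => //; apply: dvdn_trans dm; apply: dvdn_gcdr.
rewrite /imprimitivity_index big_nat_cond.
apply: (big_ind (fun l => forall d, (0 < d)%N -> eventually_multiples R d ->
    eventually_multiples R (gcdn d l))) => [d _|x y Hx Hy d d0 Hd|l].
- by rewrite gcdn0.
- by rewrite gcdnA; apply: Hy; [rewrite gcdn_gt0 d0 | apply: Hx].
case/andP=> /andP[l0 _] /existsP[c /(ucycle_walk l0)[x xx]] d d0 Hd.
have [b ix] := connect_walk (conn i x).
have [b' xi] := connect_walk (conn x i).
apply: (eventually_multiples_gcd R0 RD (a := (b + b')%N)) => //.
  exact: walk_cat ix xi.
have -> : (b + b' + l = b + (l + b'))%N by rewrite -addnA [(b' + l)%N]addnC.
by apply: walk_cat ix _; apply: walk_cat xi.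
Qed.

End BooleanMatrix.

(** * The digraph of a matrix in linear block form *)

Section LinearBlockShape.

Variables (eta : nat) (kappa : 'I_eta.+1 -> nat).
Variable w : forall p : 'I_eta.+1, 'I_(kappa p) -> nat.
Variable M : 'M[boole]_(\sum_(p < eta.+1) block_order w p).
Hypotheses (shapeM : linear_block_shape M)
  (order_gt1 : forall p, (1 < block_order w p)%N).

Let vertex := 'I_(\sum_(p < eta.+1) block_order w p).
Let e : rel vertex := adjacency M.
Let node (p : 'I_eta.+1) (x : 'I_(block_order w p)) : vertex :=
  tagnat.Rank p x.
Let level (u : vertex) : 'I_eta.+1 := tagnat.sig1 u.
Let group_of (u : vertex) : nat := tagnat.sig1 (tagnat.sig2 u).
Let period := kappa ord_max.

Lemma node_ex u : exists x : 'I_(block_order w (level u)), u = node x.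
Proof. by exists (tagnat.sig2 u); rewrite /node tagnat.sig2K. Qed.

Lemma level_node p (x : 'I_(block_order w p)) : level (node x) = p.
Proof. exact: tagnat.Rank1K. Qed.

Lemma group_of_node p (x : 'I_(block_order w p)) :
  group_of (node x) = tagnat.sig1 x.
Proof.
by rewrite /group_of /tagnat.sig2 /tagnat.sig1 /node /tagnat.Rank tagnat.rankK.
Qed.

Lemma edge_nodeE p p' (x : 'I_(block_order w p)) (x' : 'I_(block_order w p')) :
  e (node x) (node x') = (block M p p' x x' != 0).
Proof. by rewrite /e /adjacency /= mxE. Qed.

Lemma edge_level u v :
  e u v -> level v = level u :> nat \/ level v = (level u).+1 :> nat.
Proof.
have [x Eu] := node_ex u; have [y Ev] := node_ex v.
rewrite {1}Eu {1}Ev edge_nodeE; have [_ _ M0 _] := shapeM.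
have [|vu] := eqVneq (level v : nat) (level u); first by left.
have [|vSu] := eqVneq (level v : nat) (level u).+1; first by right.
by rewrite M0 // mxE eqxx.
Qed.

Lemma kappaE p : kappa p = imprimitivity_index (block M p p).
Proof. by have [_ _ _ H] := shapeM; have [] := H p (order_gt1 p). Qed.

Lemma kappa_gt0 p : (0 < kappa p)%N.
Proof.
rewrite lt0n; apply/eqP => k0; have := order_gt1 p.
suff -> : block_order w p = 0%N by [].
by apply: big1 => -[i i_lt]; exfalso; rewrite k0 in i_lt.
Qed.

Lemma group_potential p :
  potential (adjacency (block M p p)) (kappa p)
    (fun x => (tagnat.sig1 x : nat)%:Z).
Proof.
move=> x y; rewrite /adjacency /=.
have [_ _ _ /(_ p (order_gt1 p))[_ cyc]] := shapeM.
have [yx _|/cyc Mxy] := eqVneq (tagnat.sig1 y) (ordS (tagnat.sig1 x)); last first.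
  have := congr1 (fun B : 'M_ _ => B (tagnat.sig2 x) (tagnat.sig2 y)) Mxy.
  by rewrite /= !mxE !tagnat.sig2K => ->; rewrite eqxx.
rewrite yx /=; set i := (tagnat.sig1 x : nat).
(* [ordS] reduces [i.+1] modulo [kappa p]; the quotient of that division is what is lost. *)
apply/dvdzP; exists (- (i.+1 %/ kappa p)%N%:Z).
by have := divn_eq i.+1 (kappa p); lia.
Qed.

Lemma node_connect p (x y : 'I_(block_order w p)) : connect e (node x) (node y).
Proof.
have [/(_ p)[_ /(_ x y)/connect_walk[m xy]] _ _ _] := shapeM.
have [q [qP _ <-]] : walk e m (node x) (node y).
  by apply: walk_map xy => a b ab; rewrite edge_nodeE.
by apply/connectP; exists q.
Qed.

Lemma level_connect u v : level u = level v -> connect e u v.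
Proof.
have [x Eu] := node_ex u; have [y Ev] := node_ex v => uv.
rewrite {}Eu {}Ev; rewrite -uv in y *; exact: node_connect.
Qed.

Lemma edge_out u : exists v, e u v.
Proof.
have [x ->] := node_ex u; have [irr _ _ _] := shapeM.
have [y xy] := irreducible_out x (irr (level u)) (order_gt1 _).
by exists (node y); rewrite edge_nodeE.
Qed.

Lemma edge_step (p p' : 'I_eta.+1) : p' = p.+1 :> nat ->
  exists (x : 'I_(block_order w p)) (y : 'I_(block_order w p')),
    e (node x) (node y).
Proof.
have [_ step _ _] := shapeM => /step/mx_neq0_ex[x [y xy]].
by exists x, y; rewrite edge_nodeE.
Qed.

(** Induction on the number of blocks still ahead: move inside the block to the source of an edge
    into the next one. *)
Lemma reach_last u : exists2 v, level v == ord_max & connect e u v.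
Proof.
move Em : (eta - level u)%N => m; elim: m u Em => [|m IH] u Em.
  by exists u; rewrite // -val_eqE /=; have := ltn_ord (level u); lia.
have lt_u : ((level u).+1 < eta.+1)%N by lia.
have [x [y xy]] := @edge_step (level u) (Ordinal lt_u) erefl.
have [|v lv yv] := IH (node y); first by rewrite level_node /=; lia.
exists v => //; apply: connect_trans yv.
apply: connect_trans (connect1 xy).
by apply: level_connect; rewrite level_node.
Qed.

Lemma group_edge u v : e u v -> level v = level u ->
  (kappa (level u) %| (group_of v)%:Z - (group_of u)%:Z - 1)%Z.
Proof.
have [x Eu] := node_ex u; have [y Ev] := node_ex v => + luv.
rewrite {1 2}Eu {}Ev; rewrite luv in y *.
by rewrite edge_nodeE !group_of_node; apply: group_potential.
Qed.

Lemma sink_group u v : level u == ord_max -> e u v ->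
  level v == ord_max /\ (period %| (group_of v)%:Z - (group_of u)%:Z - 1)%Z.
Proof.
move=> lu uv; have lv : level v == ord_max.
  move: lu; rewrite -!val_eqE /= => /eqP lu; have := ltn_ord (level v).
  by have [|] := edge_level uv; lia.
split=> //; rewrite /period -(eqP lu); apply: group_edge => //.
by rewrite (eqP lu) (eqP lv).
Qed.

Lemma sink_period u : level u == ord_max ->
  eventually_multiples (fun m => walk e m u u) period.
Proof.
move=> lu; have [x ->] := node_ex u; rewrite (eqP lu) in x *.
have [irr _ _ _] := shapeM.
have [N HN] := irreducible_period x (irr ord_max) (order_gt1 ord_max).
exists N => m mN; rewrite /period kappaE => /(HN m mN).
by apply: walk_map => a b ab; rewrite edge_nodeE.
Qed.

Lemma JBD_potential L :
  has_limit (fun m => Gamma (M ^+ m)) L ->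
  JBD L <-> exists f, potential e period f.
Proof.
move=> /(limit_Gamma_common_prey edge_out) LE.
pose S := [pred u | level u == ord_max].
have cP : forall u v, S u -> e u v -> S v.
  by move=> u v Su /(sink_group Su)[].
have gP u v : S u -> e u v ->
    (period %| (group_of v)%:Z - (group_of u)%:Z - 1)%Z.
  by move=> Su /(sink_group Su)[].
have conn u v : S u -> S v -> connect e u v.
  by move=> /eqP lu /eqP lv; apply: level_connect; rewrite lu.
split.
  move=> /JBD_classes[c Lc].
  apply: (common_prey_class_potential (kappa_gt0 _) edge_out reach_last cP conn
    sink_period gP (c := c)) => u v.
  (* The diagonal of [L] says nothing, but a vertex shares a prey with itself through the empty
     walk. *)
  have [->|uv] := eqVneq u v.
    by split=> // _; exists 0%N, v; split; apply: walk0.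
  have [L1 L2] := LE u v; have [L3 L4] := Lc u v; split.
    by move=> cp; have [] := L3 (L2 (conj uv cp)).
  by move=> cuv; have [] := L1 (L4 (conj uv cuv)).
move=> [f fP]; apply: (@classes_JBD _ _ (fun u => (f u %% period)%Z)) => u v.
rewrite LE (potential_common_prey (kappa_gt0 _) reach_last cP conn
  sink_period gP fP) //.
Qed.

(** On each block a potential is the group number up to a constant. As the blocks form a path, the
    constants can be chosen one after another, and the only obstruction is a disagreement among
    edges of the same step. *)
Lemma potential_levels :
  (exists f, potential e period f) <->
  (forall p p' : 'I_eta.+1, p' = p.+1 :> nat ->
     (period %| kappa p)%N /\
     forall u v u' v', level u = p -> level v = p' -> e u v ->
       level u' = p -> level v' = p' -> e u' v' ->
       (period %| ((group_of u)%:Z - (group_of v)%:Z) -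
                  ((group_of u')%:Z - (group_of v')%:Z))%Z).
Proof.
split=> [[f fP]|H].
  have fp p : potential (adjacency (block M p p)) period (fun x => f (node x)).
    by move=> x y xy; apply: fP; rewrite edge_nodeE.
  have kp p : (period %| kappa p)%N.
    by rewrite kappaE; apply: imprimitivity_index_dvdn (fp p).
  (* Both [f] and the group number grow by one along edges of a block, so their difference is
     constant modulo [period] there. *)
  have fg u v : level u = level v ->
      (period %| (f u - (group_of u)%:Z) - (f v - (group_of v)%:Z))%Z.
    have [x Eu] := node_ex u; have [y Ev] := node_ex v => uv.
    rewrite {}Eu {}Ev; rewrite -uv in y *; rewrite !group_of_node.
    have [irr _ _ _] := shapeM; have [_ conn] := irr (level u).
    pose h (z : 'I_(block_order w (level u))) :=
      f (node z) - (tagnat.sig1 z : nat)%:Z.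
    apply: (connect_invariant (h := h) _ (conn y x)) => a b ab; rewrite /h.
    have /dvdzP[q Eq] := fp _ _ _ ab.
    have /dvdzP[r Er] := group_potential ab.
    have /dvdnP[s Es] := kp (level u).
    by apply/dvdzP; exists (q - r * s%:Z); lia.
  move=> p p' pp'; split=> // u v u' v' lu lv uv lu' lv' uv'.
  have /dvdzP[a Ea] := fg u u' (etrans lu (esym lu')).
  have /dvdzP[b Eb] := fg v v' (etrans lv (esym lv')).
  have /dvdzP[c Ec] := fP _ _ uv; have /dvdzP[d Ed] := fP _ _ uv'.
  by apply/dvdzP; exists (b - a - c + d); lia.
have /fin_all_exists[o oP] (p : 'I_eta.+1) : exists o : int, forall u v,
    level u = p -> level v = p.+1 :> nat -> e u v ->
    (period %| (group_of u)%:Z - (group_of v)%:Z - o)%Z.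
  have [pe|pe] := ltnP p.+1 eta.+1; last first.
    (* No edge leaves the last block for a higher one, so the value is arbitrary. *)
    by exists 0 => u v _ lv; have := ltn_ord (level v); lia.
  have [x [y xy]] := @edge_step p (Ordinal pe) erefl.
  exists ((group_of (node x))%:Z - (group_of (node y))%:Z) => u v lu lv uv.
  have [_] := H p (Ordinal pe) erefl.
  by apply=> //; rewrite ?level_node //; apply: val_inj.
(* Crossing from block [i] to the next changes the group number by [- o i] modulo [period]; the
   shift [o i + 1] turns this into an increase of one. *)
pose s (p : nat) := \sum_(i < p) (o (inord i) + 1).
exists (fun u => (group_of u)%:Z + s (level u)) => u v uv.
have [luv|luv] := edge_level uv.
  have kp : (period %| kappa (level u))%N.
    have [pe|pe] := ltnP (level u).+1 eta.+1.
      by have [] := H _ (Ordinal pe) erefl.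
    have -> // : level u = ord_max.
    by apply/val_inj => /=; have := ltn_ord (level u); lia.
  move: luv => /val_inj luv; rewrite luv.
  have /dvdzP[q Eq] := group_edge uv luv.
  by have /dvdnP[r Er] := kp; apply/dvdzP; exists (q * r%:Z); lia.
have /dvdzP[q Eq] := oP _ _ _ erefl luv uv.
rewrite luv /s big_ord_recr /= inord_val -/(s _).
by apply/dvdzP; exists (- q); lia.
Qed.

End LinearBlockShape.

(** * From vertices and edges back to matrices and subblocks *)

Theorem corollary3p19 (n : nat) (A P A' : 'M[boole]_n)
    (eta : nat) (kappa : 'I_eta.+1 -> nat)
    (w : forall p : 'I_eta.+1, 'I_(kappa p) -> nat)
    (en : n = (\sum_(p < eta.+1) block_order w p)%N)
    (hdiag : forall i : 'I_n, A i i = 0)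
    (hform : linear_block_form A P en)
    (horder : forall p : 'I_eta.+1, (1 < block_order w p)%N)
    (hlim : has_limit (fun m : nat => Gamma (A ^+ m)) A') :
  JBD (P *m A' *m P^T) <->
  (forall p p' : 'I_eta.+1, p' = p.+1 :> nat ->
     (kappa ord_max %| kappa p)%N /\
     forall (i i' : 'I_(kappa p)) (j j' : 'I_(kappa p')),
       subblock (castmx (en, en) (P *m A *m P^T)) i j != 0 ->
       subblock (castmx (en, en) (P *m A *m P^T)) i' j' != 0 ->
       (i%:Z - j%:Z = i'%:Z - j'%:Z %[mod (kappa ord_max)%:Z])%Z).
Proof.
case: hform => /is_perm_mxP[s ->]; subst n; rewrite castmx_id => shape.
(* Relabelling the vertices commutes with powers and with [Gamma], so the permuted matrix can
   replace [A]. *)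
have lim : has_limit
    (fun m => Gamma ((perm_mx s *m A *m (perm_mx s)^T) ^+ m))
    (perm_mx s *m A' *m (perm_mx s)^T).
  have [N HN] := hlim; exists N => m /HN <-.
  by rewrite perm_conj_exp Gamma_perm_conj.
move: shape lim; set M := perm_mx s *m A *m _ => shape lim.
rewrite (JBD_potential shape horder lim) (potential_levels shape horder).
split=> H p p' pp'; have [kp {}H] := H p p' pp'; split=> //.
  (* A nonzero entry of a subblock is an edge between the corresponding groups. *)
  have edge (i : 'I_(kappa p)) (j : 'I_(kappa p')) : subblock M i j != 0 ->
      exists u v, [/\ tagnat.sig1 u = p, tagnat.sig1 v = p', adjacency M u v,
        tagnat.sig1 (tagnat.sig2 u) = i :> nat &
        tagnat.sig1 (tagnat.sig2 v) = j :> nat].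
    move=> /mx_neq0_ex[x [y xy]].
    pose a : 'I_(block_order w p) := tagnat.Rank i x.
    pose b : 'I_(block_order w p') := tagnat.Rank j y.
    exists (tagnat.Rank p a), (tagnat.Rank p' b).
    rewrite !group_of_node !tagnat.Rank1K; split=> //.
    by move: xy; rewrite /adjacency /= !mxE.
  move=> i i' j j' /edge[u [v [lu lv uv <- <-]]].
  move=> /edge[u' [v' [lu' lv' uv' <- <-]]].
  by apply/eqP; rewrite eqz_mod_dvd; apply: H lu lv uv lu' lv' uv'.
(* Conversely, the groups of the ends of an edge index a nonzero subblock. *)
have sub u v : tagnat.sig1 u = p -> tagnat.sig1 v = p' -> adjacency M u v ->
    exists (i : 'I_(kappa p)) (j : 'I_(kappa p')),
    [/\ subblock M i j != 0, tagnat.sig1 (tagnat.sig2 u) = i :> nat &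
        tagnat.sig1 (tagnat.sig2 v) = j :> nat].
  move=> <- <- uv.
  exists (tagnat.sig1 (tagnat.sig2 u)), (tagnat.sig1 (tagnat.sig2 v)); split=> //.
  apply: contraTneq uv => M0.
  have := congr1 (fun B : 'M_(_, _) =>
    B (tagnat.sig2 (tagnat.sig2 u)) (tagnat.sig2 (tagnat.sig2 v))) M0.
  by rewrite /adjacency /= !mxE !tagnat.sig2K negbK => ->.
move=> u v u' v' lu lv uv lu' lv' uv'.
have [i [j [Mij -> ->]]] := sub u v lu lv uv.
have [i' [j' [Mij' -> ->]]] := sub u' v' lu' lv' uv'.
by rewrite -eqz_mod_dvd; apply/eqP; apply: H.
Qed.
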